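(* Let $\mathcal{W}(k)\subseteq\mathrm{Bilin}_{d,d,d}^{r_1,r_2}(\mathbb{A}^n)(k)$ be the set of points $[p_1,p_2,\pi]$, $p_i\colon S^{\oplus r_i}\twoheadrightarrow M_i$ ($i=1,2$), $\pi\colon M_1\otimes_SM_2\twoheadrightarrow M_3$, such that there is an ideal $I\subseteq S$ corresponding to a tuple of $d$ points with $M_j\simeq S/I$ for $j=1,2,3$. Then for a point of $\mathcal{W}(k)$ the map $\pi\colon M_1\otimes_SM_2\twoheadrightarrow M_3$ is unique up to isomorphism (i.e. up to the identification of surjections with equal kernels); hence the points of $\mathcal{W}(k)$ are determined by the surjections $p_j\colon S^{\oplus r_j}\twoheadrightarrow M_j\simeq S/I$ for $j=1,2$.
   Context: Let $k$ be an infinite algebraically closed field, $S=k[x_1,\dots,x_n]$, $\mathbb{A}^n=\operatorname{Spec}S$; $n,d,r_1,r_2\ge1$ are integers. A point of $\mathrm{Bilin}_{d,d,d}^{r_1,r_2}(\mathbb{A}^n)(k)$ is a triple $[p_1,p_2,\pi]$ of $S$-linear surjections $p_i\colon S^{\oplus r_i}\twoheadrightarrow M_i$ ($i=1,2$) and $\pi\colon M_1\otimes_SM_2\twoheadrightarrow M_3$ with $\dim_kM_j=d$ for $j=1,2,3$, surjections with equal kernels being identified. An ideal $I\subseteq S$ corresponds to a tuple of $d$ points if it is the (radical) ideal of a set of $d$ distinct $k$-points of $\mathbb{A}^n$, so that $S/I\simeq k^d$ as $k$-algebras. *)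

(* Defs.v *)
From HB Require Import structures.
From mathcomp Require Import all_boot all_algebra.
From mathcomp Require Import boolp.
From mathcomp Require Import freeg mpoly.

Set Implicit Arguments.
Unset Strict Implicit.
Unset Printing Implicit Defensive.

Import GRing.Theory.
Local Open Scope ring_scope.
Local Open Scope quotient_scope.

Definition surjective (A B : Type) (f : A -> B) : Prop :=
  forall b, exists a, f a = b.

Definition same_ker (A : Type) (B C : zmodType) (f : A -> B) (g : A -> C) : Prop :=
  forall a, f a = 0 <-> g a = 0.

Definition lmod_iso (R : nzRingType) (U V : lmodType R) : Prop :=
  exists f : {linear U -> V}, bijective f.

(* Isomorphism of quotients of U, i.e. of surjections with source U. *)
Definition quot_iso (R : nzRingType) (U V W : lmodType R) (f : U -> V) (g : U -> W) :
    Prop :=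
  exists2 h : {linear V -> W}, bijective h & g =1 h \o f.

Section QuotientModule.
Variables (R : nzRingType) (V : lmodType R) (N : submodClosed V).

Definition submod_zmodClosed : zmodClosed V :=
  HB.pack (N : {pred V})
    (GRing.isZmodClosed.Build V (N : {pred V}) (GRing.submod_closedB (submodClosedP N))).

Definition lmod_quot : Type := Quotient.quot submod_zmodClosed.

HB.instance Definition _ := GRing.Zmodule.copy lmod_quot (Quotient.quot submod_zmodClosed).

Definition lmod_proj (v : V) : lmod_quot := \pi_(Quotient.quot submod_zmodClosed) v.

Lemma lmod_projP u v : (lmod_proj u = lmod_proj v) <-> (u - v \in N).
Proof.
have E : (u - v \in N) = (lmod_proj u == lmod_proj v).
  exact: (Quotient.idealrBE submod_zmodClosed).
by rewrite E; split=> /eqP.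
Qed.

Lemma lmod_proj_surj : surjective lmod_proj.
Proof. by move=> x; exists (repr x); rewrite /lmod_proj reprK. Qed.

Lemma lmod_projB : {morph lmod_proj : u v / u - v}.
Proof. by move=> u v; rewrite /lmod_proj [LHS]raddfB. Qed.

Lemma lmod_projD : {morph lmod_proj : u v / u + v}.
Proof. by move=> u v; rewrite /lmod_proj [LHS]raddfD. Qed.

Definition lmod_quot_scale (c : R) (x : lmod_quot) : lmod_quot :=
  lmod_proj (c *: repr x).

Lemma lmod_quot_scaleE c v : lmod_quot_scale c (lmod_proj v) = lmod_proj (c *: v).
Proof.
apply/lmod_projP; rewrite -scalerBr rpredZ //.
by apply/lmod_projP; rewrite /lmod_proj reprK.
Qed.

Fact lmod_quot_scaleA a b x :
  lmod_quot_scale a (lmod_quot_scale b x) = lmod_quot_scale (a * b) x.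
Proof.
by have [v <-] := lmod_proj_surj x; rewrite !lmod_quot_scaleE scalerA.
Qed.

Fact lmod_quot_scale1 : left_id 1 lmod_quot_scale.
Proof.
by move=> x; have [v <-] := lmod_proj_surj x; rewrite lmod_quot_scaleE scale1r.
Qed.

Fact lmod_quot_scaleDr : right_distributive lmod_quot_scale +%R.
Proof.
move=> a x y; have [u <-] := lmod_proj_surj x; have [v <-] := lmod_proj_surj y.
by rewrite -lmod_projD !lmod_quot_scaleE scalerDr lmod_projD.
Qed.

Fact lmod_quot_scaleDl x : {morph lmod_quot_scale^~ x : a b / a + b}.
Proof.
move=> a b; have [u <-] := lmod_proj_surj x.
by rewrite !lmod_quot_scaleE scalerDl lmod_projD.
Qed.

HB.instance Definition _ := GRing.Zmodule_isLmodule.Build R lmod_quot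
  lmod_quot_scaleA lmod_quot_scale1 lmod_quot_scaleDr lmod_quot_scaleDl.

Fact lmod_proj_is_linear : linear lmod_proj.
Proof. by move=> c u v; rewrite lmod_projD -lmod_quot_scaleE. Qed.

HB.instance Definition _ :=
  GRing.isLinear.Build R V lmod_quot _ lmod_proj lmod_proj_is_linear.

Section Descent.
Variables (W : lmodType R) (f : {linear V -> W}).

Definition lmod_quot_lift (fN : {in N, forall v, f v = 0}) (x : lmod_quot) : W :=
  f (repr x).

Hypothesis fN : {in N, forall v, f v = 0}.

Lemma lmod_quot_liftE v : lmod_quot_lift fN (lmod_proj v) = f v.
Proof.
have kN : repr (lmod_proj v) - v \in N.
  by apply/lmod_projP; rewrite /lmod_proj reprK.
by apply/eqP; rewrite -subr_eq0 -[X in X == _]raddfB; apply/eqP/fN.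
Qed.

Fact lmod_quot_lift_is_linear : linear (lmod_quot_lift fN).
Proof.
move=> c x y; have [u <-] := lmod_proj_surj x; have [v <-] := lmod_proj_surj y.
by rewrite -linearP !lmod_quot_liftE linearP.
Qed.

HB.instance Definition _ := GRing.isLinear.Build R lmod_quot W _
  (lmod_quot_lift fN) lmod_quot_lift_is_linear.

End Descent.
End QuotientModule.

Section Span.
Variables (R : nzRingType) (V : lmodType R) (A : V -> Prop).

(* The smallest submodule of V containing A. *)
Definition span_pred : {pred V} :=
  fun v => `[< forall W : submodClosed V, (forall a, A a -> a \in W) -> v \in W >].

Fact span_is_submod : submod_closed span_pred.
Proof.
split=> [|c u v /asboolP su /asboolP sv]; apply/asboolP=> W AW.
  exact: rpred0.
by rewrite rpredD ?rpredZ ?su ?sv.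
Qed.

HB.instance Definition _ := GRing.isSubmodClosed.Build R V span_pred
  (GRing.submod_closed_semi span_is_submod).

Definition span : submodClosed V := span_pred.

Lemma mem_span a : A a -> a \in span.
Proof. by move=> Aa; apply/asboolP=> W; apply. Qed.

End Span.

Section SpanKernel.
Variables (R : nzRingType) (V W : lmodType R) (A : V -> Prop) (f : {linear V -> W}).

Definition ker_pred : {pred V} := fun v => f v == 0.

Fact ker_is_submod : submod_closed ker_pred.
Proof.
split=> [|c u v /eqP fu /eqP fv]; apply/eqP; first exact: linear0.
by rewrite linearP fu fv scaler0 addr0.
Qed.

HB.instance Definition _ := GRing.isSubmodClosed.Build R V ker_pred
  (GRing.submod_closed_semi ker_is_submod).

Lemma span_ker : (forall a, A a -> f a = 0) -> {in span A, forall v, f v = 0}.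
Proof.
move=> fA v /asboolP sv; apply/eqP; apply: (sv ker_pred) => a Aa.
by apply/eqP; apply: fA.
Qed.

End SpanKernel.

Section FreeModule.
Variables (R : nzRingType) (K : choiceType) (W : lmodType R) (f : K -> W).

Definition fgmor (D : {freeg K / R}) : W := fglift f D.

Fact fgmor_is_linear : linear fgmor.
Proof.
have addf : {morph fgmor : D E / D + E}.
  move=> D E; have B := lift_is_additive f.
  have N0 : fglift f 0 = 0 by rewrite -(subrr 0) B subrr.
  have NE : fglift f (- E) = - fglift f E by rewrite -sub0r B N0 sub0r.
  by rewrite /fgmor -{1}[E]opprK B NE opprK.
have f0 : fgmor 0 = 0 by apply: (addrI (fgmor 0)); rewrite -addf !addr0.
move=> c D E; rewrite addf; congr (_ + _).
rewrite -{2}[D]freeg_sumE [c *: D]/(fgscale c D) /fgscale.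
rewrite !(big_morph fgmor addf f0) scaler_sumr; apply: eq_bigr => x _.
by rewrite /fgmor !liftU scalerA.
Qed.

HB.instance Definition _ := GRing.isLinear.Build R {freeg K / R} W _
  fgmor fgmor_is_linear.

Lemma fgmorU x : fgmor << x >> = f x.
Proof. by rewrite /fgmor liftU scale1r. Qed.

End FreeModule.

Section Tensor.
Variables (R : comNzRingType) (M N : lmodType R).

(* M (x)_R N is the free R-module on M * N modulo the bilinearity relations; see
   tensor_liftE and tensor_ext for its universal property. *)
Inductive tensor_rel : {freeg (M * N) / R} -> Prop :=
| TensorAddl m m' n : tensor_rel (<< (m + m', n) >> - (<< (m, n) >> + << (m', n) >>))
| TensorAddr m n n' : tensor_rel (<< (m, n + n') >> - (<< (m, n) >> + << (m, n') >>))
| TensorScalel c m n : tensor_rel (<< (c *: m, n) >> - c *: << (m, n) >>)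
| TensorScaler c m n : tensor_rel (<< (m, c *: n) >> - c *: << (m, n) >>).

Definition tensor : Type := lmod_quot (span tensor_rel).

HB.instance Definition _ := GRing.Lmodule.on tensor.

Definition tmul (m : M) (n : N) : tensor := lmod_proj (span tensor_rel) << (m, n) >>.

Lemma tmulDl m m' n : tmul (m + m') n = tmul m n + tmul m' n.
Proof.
rewrite /tmul -[RHS]raddfD; apply/lmod_projP; apply: mem_span; exact: TensorAddl.
Qed.

Lemma tmulDr m n n' : tmul m (n + n') = tmul m n + tmul m n'.
Proof.
rewrite /tmul -[RHS]raddfD; apply/lmod_projP; apply: mem_span; exact: TensorAddr.
Qed.

Lemma tmulZl c m n : tmul (c *: m) n = c *: tmul m n.
Proof.
rewrite /tmul -[RHS]linearZ; apply/lmod_projP; apply: mem_span; exact: TensorScalel.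
Qed.

Lemma tmulZr c m n : tmul m (c *: n) = c *: tmul m n.
Proof.
rewrite /tmul -[RHS]linearZ; apply/lmod_projP; apply: mem_span; exact: TensorScaler.
Qed.

Fact tmul_is_bilinear : bilinear_for *:%R *:%R tmul.
Proof.
by split=> u c x y; rewrite ?tmulDl ?tmulZl ?tmulDr ?tmulZr.
Qed.

HB.instance Definition _ := bilinear_isBilinear.Build R M N tensor *:%R *:%R tmul
  tmul_is_bilinear.

Lemma tensor_ext (W : lmodType R) (f g : {linear tensor -> W}) :
  (forall m n, f (tmul m n) = g (tmul m n)) -> f =1 g.
Proof.
move=> fg x; have [D <-] := lmod_proj_surj x.
rewrite -[D]freeg_sumE linear_sum !linear_sum; apply: eq_bigr => -[m n] _.
have -> : << coeff (m, n) D *g (m, n) >> = coeff (m, n) D *: << (m, n) >>.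
  by apply/eqP/freeg_eqP => z; rewrite coeffZ !coeffU mul1r.
by rewrite !linearZ_LR; congr (_ *: _); apply: fg.
Qed.

Section Lift.
Variables (W : lmodType R) (h : {bilinear M -> N -> W}).

Fact tensor_lift_subproof :
  {in span tensor_rel, forall D, fgmor (fun mn => h mn.1 mn.2) D = 0}.
Proof.
apply: span_ker => _ [m m' n|m n n'|c m n|c m n]; apply/eqP.
- by rewrite linearB subr_eq0 linearD /= !fgmorU /= linearDl.
- by rewrite linearB subr_eq0 linearD /= !fgmorU /= linearDr.
- by rewrite linearB subr_eq0 linearZ_LR /= !fgmorU /= linearZl_LR.
- by rewrite linearB subr_eq0 linearZ_LR /= !fgmorU /= linearZr_LR.
Qed.

Definition tensor_lift : {linear tensor -> W} := lmod_quot_lift tensor_lift_subproof.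

Lemma tensor_liftE m n : tensor_lift (tmul m n) = h m n.
Proof. by rewrite [LHS]lmod_quot_liftE /= fgmorU. Qed.

End Lift.
End Tensor.

Section TensorMap.
Variables (R : comNzRingType) (M M' N N' : lmodType R).
Variables (f : {linear M -> M'}) (g : {linear N -> N'}).

Definition tmul_map (m : M) (n : N) : tensor M' N' := tmul (f m) (g n).

Fact tmul_map_is_bilinear : bilinear_for *:%R *:%R tmul_map.
Proof.
by split=> u c x y; rewrite /tmul_map linearP ?tmulDl ?tmulZl ?tmulDr ?tmulZr.
Qed.

HB.instance Definition _ := bilinear_isBilinear.Build R M N (tensor M' N')
  *:%R *:%R tmul_map tmul_map_is_bilinear.

Definition tensor_map : {linear tensor M N -> tensor M' N'} := tensor_lift tmul_map.

Lemma tensor_mapE m n : tensor_map (tmul m n) = tmul (f m) (g n).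
Proof. exact: tensor_liftE. Qed.

End TensorMap.

(* S / I as an S-module, on top of the quotient ring of the library. *)
Section IdealQuotientModule.
Variables (R : comNzRingType) (I : idealr R).

Definition ideal_quot_scale (a : R) (x : {ideal_quot I}) : {ideal_quot I} :=
  \pi_({ideal_quot I}) a * x.

Fact ideal_quot_scaleA a b x :
  ideal_quot_scale a (ideal_quot_scale b x) = ideal_quot_scale (a * b) x.
Proof. by rewrite /ideal_quot_scale rmorphM mulrA. Qed.

Fact ideal_quot_scale1 : left_id 1 ideal_quot_scale.
Proof. by move=> x; rewrite /ideal_quot_scale rmorph1 mul1r. Qed.

Fact ideal_quot_scaleDr : right_distributive ideal_quot_scale +%R.
Proof. by move=> a x y; rewrite /ideal_quot_scale mulrDr. Qed.

Fact ideal_quot_scaleDl x : {morph ideal_quot_scale^~ x : a b / a + b}.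
Proof. by move=> a b; rewrite /ideal_quot_scale rmorphD mulrDl. Qed.

HB.instance Definition _ := GRing.Zmodule_isLmodule.Build R {ideal_quot I}
  ideal_quot_scaleA ideal_quot_scale1 ideal_quot_scaleDr ideal_quot_scaleDl.

End IdealQuotientModule.

Section ScalarRestriction.
Variables (n : nat) (k : comNzRingType) (M : lmodType {mpoly k[n]}).

(* M as a k-module, through the constant polynomials. *)
Definition kspace : Type := M.

HB.instance Definition _ := GRing.Zmodule.on kspace.

Definition kspace_scale (c : k) (m : kspace) : kspace := c%:MP *: (m : M).

Fact kspace_scaleA a b m : kspace_scale a (kspace_scale b m) = kspace_scale (a * b) m.
Proof. by rewrite /kspace_scale scalerA -mpolyCM. Qed.

Fact kspace_scale1 : left_id 1 kspace_scale.
Proof. by move=> m; rewrite /kspace_scale mpolyC1 scale1r. Qed.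

Fact kspace_scaleDr : right_distributive kspace_scale +%R.
Proof. by move=> a x y; rewrite /kspace_scale scalerDr. Qed.

Fact kspace_scaleDl m : {morph kspace_scale^~ m : a b / a + b}.
Proof. by move=> a b; rewrite /kspace_scale mpolyCD scalerDl. Qed.

HB.instance Definition _ := GRing.Zmodule_isLmodule.Build k kspace
  kspace_scaleA kspace_scale1 kspace_scaleDr kspace_scaleDl.

(* dim_k M = d: a k-linear bijection of M with 'rV[k]_d. *)
Definition has_kdim (d : nat) : Prop := inhabited (Vector.axiom d kspace).

End ScalarRestriction.

(* A representative [p_1, p_2, pi] of a k-point of Bilin_{d,d,d}^{r1,r2}(A^n);
   two representatives give the same point when they are related by same_pt. *)
Record bilin_pt (k : fieldType) (n d r1 r2 : nat) := BilinPt {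
  bmod1 : lmodType {mpoly k[n]};
  bmod2 : lmodType {mpoly k[n]};
  bmod3 : lmodType {mpoly k[n]};
  bp1 : {linear 'rV[{mpoly k[n]}]_r1 -> bmod1};
  bp2 : {linear 'rV[{mpoly k[n]}]_r2 -> bmod2};
  bpi : {linear tensor bmod1 bmod2 -> bmod3};
  bp1_surj : surjective bp1;
  bp2_surj : surjective bp2;
  bpi_surj : surjective bpi;
  bdim1 : has_kdim bmod1 d;
  bdim2 : has_kdim bmod2 d;
  bdim3 : has_kdim bmod3 d
}.

(* Surjections with equal kernels are identified: p_i and p_i' have equal kernels,
   and pi and pi' have equal kernels after the resulting (unique) identifications
   f_i of M_i with M_i'. *)
Definition same_pt (k : fieldType) (n d r1 r2 : nat) (x y : bilin_pt k n d r1 r2) :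
    Prop :=
  [/\ same_ker (bp1 x) (bp1 y), same_ker (bp2 x) (bp2 y) &
      exists (f1 : {linear bmod1 x -> bmod1 y}) (f2 : {linear bmod2 x -> bmod2 y}),
        [/\ bp1 y =1 f1 \o bp1 x, bp2 y =1 f2 \o bp2 x &
            same_ker (bpi x) (bpi y \o tensor_map f1 f2)]].

(* I is the ideal of all polynomials vanishing on d distinct k-points of A^n. *)
Definition ideal_of_points (k : fieldType) (n d : nat) (I : idealr {mpoly k[n]}) :
    Prop :=
  exists2 P : d.-tuple {ffun 'I_n -> k},
    uniq P & forall f : {mpoly k[n]}, f \in I <-> (forall v, v \in P -> f.@[v] = 0).

Definition inW (k : fieldType) (n d r1 r2 : nat) (x : bilin_pt k n d r1 r2) : Prop :=
  exists2 I : idealr {mpoly k[n]}, ideal_of_points d I &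
    [/\ lmod_iso (bmod1 x) {ideal_quot I}, lmod_iso (bmod2 x) {ideal_quot I} &
        lmod_iso (bmod3 x) {ideal_quot I}].

(* Main.v *)
Require Import Defs.
From HB Require Import structures.
From mathcomp Require Import all_boot all_algebra.
From mathcomp Require Import boolp.
From mathcomp Require Import freeg mpoly.

Set Implicit Arguments.
Unset Strict Implicit.
Unset Printing Implicit Defensive.

Import GRing.Theory.
Local Open Scope ring_scope.

(** A tensor product of two copies of [S / I] is cyclic: it is generated by
    [t], the tensor of the two generators, and [I] kills [t]. When [I] is the
    ideal of [d] distinct points, a cyclic module [N] of dimension [d] whose
    generator [u] is killed by [I] has annihilator exactly [I]: the Lagrange
    polynomials [e_1, ..., e_d] of the points give a family [e_i u] that spans
    [N], so none of its [d] members vanishes; but if [s u = 0] and [s] takes a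
    nonzero value at the [j]-th point, then [e_j s] is congruent to a nonzero
    multiple of [e_j] modulo [I], and [e_j u = 0] follows
    ([cyclic_ann_sub_ideal]). Hence every surjection from the tensor product
    onto a module of dimension [d] is injective ([tensor_surj_inj]): for a point
    of [W] the map [pi] is an isomorphism, and so is any other candidate.

    Two points of [W] with equal kernels of [p_1] and of [p_2] are compared
    through the induced isomorphisms [f_1], [f_2]: composing the second [pi]
    with their tensor product gives one more surjection out of the first tensor
    product onto a module of dimension [d], which the same lemma makes
    injective. *)

Lemma surj_comp (A B C : Type) (f : B -> C) (g : A -> B) :
  surjective f -> surjective g -> surjective (f \o g).
Proof. by move=> fs gs c; have [b <-] := fs c; have [a <-] := gs b; exists a. Qed.

(** The isomorphism is [g \o f'] for a set-theoretic section [f'] of [f]: equality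
    of the kernels makes [f] and [g] identify the same elements, so the choice of
    section is immaterial and the composite is linear. *)
Lemma same_ker_quot_iso (R : nzRingType) (U V W : lmodType R)
    (f : {linear U -> V}) (g : {linear U -> W}) :
  surjective f -> surjective g -> same_ker f g -> quot_iso f g.
Proof.
move=> fs gs kfg; have /choice[f' fK] := fs; have /choice[g' gK] := gs.
have fg a b : f a = f b <-> g a = g b.
  split=> /eqP; rewrite -subr_eq0 -raddfB => /eqP /kfg /eqP;
    by rewrite raddfB subr_eq0 => /eqP.
have hE a : g (f' (f a)) = g a by apply/fg; rewrite fK.
have hlin : linear (g \o f').
  move=> c x y /=; rewrite -linearP; apply/fg.
  by rewrite fK linearP !fK.
pose hL := GRing.isLinear.Build R V W _ (g \o f') hlin.
pose h : {linear V -> W} := HB.pack (g \o f') hL.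
exists h => [|a]; last by rewrite /= hE.
exists (f \o g') => [x|y] /=; last by rewrite hE gK.
by rewrite -[RHS]fK; apply/fg; rewrite gK.
Qed.

Section TensorInduction.
Variables (R : comNzRingType) (M N : lmodType R).

(** A scalar is absorbed by the first factor of a pure tensor, so plain sums of pure
    tensors exhaust the tensor product. *)
Lemma tensor_ind (P : tensor M N -> Prop) :
  P 0 -> (forall x y, P x -> P y -> P (x + y)) -> (forall m n, P (tmul m n)) ->
  forall x, P x.
Proof.
move=> P0 PD Pt x; have [D <-] := lmod_proj_surj x.
rewrite -[D]freeg_sumE linear_sum; elim/big_ind: _ => // -[m n] _.
have -> : << coeff (m, n) D *g (m, n) >> = coeff (m, n) D *: << (m, n) >>.
  by apply/eqP/freeg_eqP => z; rewrite coeffZ !coeffU mul1r.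
rewrite linearZ_LR.
by have := Pt (coeff (m, n) D *: m) n; rewrite tmulZl.
Qed.

End TensorInduction.

Lemma tensor_map_surj (R : comNzRingType) (M M' N N' : lmodType R)
    (f : {linear M -> M'}) (g : {linear N -> N'}) :
  surjective f -> surjective g -> surjective (tensor_map f g).
Proof.
move=> fs gs; apply: tensor_ind => [|_ _ [x <-] [y <-]|m' n'].
- by exists 0; rewrite linear0.
- by exists (x + y); rewrite linearD.
- have [m <-] := fs m'; have [n <-] := gs n'.
  by exists (tmul m n); rewrite tensor_mapE.
Qed.

Definition generates (R : nzRingType) (M : lmodType R) (u : M) : Prop :=
  forall m, exists s, m = s *: u.

Definition killed_by (R : nzRingType) (I : {pred R}) (M : lmodType R) (u : M) : Prop :=
  {in I, forall s, s *: u = 0}.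

Lemma ideal_quot_cyclic (R : comNzRingType) (I : idealr R) (M : lmodType R) :
  lmod_iso M {ideal_quot I} -> exists2 e : M, generates e & killed_by I e.
Proof.
move=> [f [g fK gK]]; have sE s : f (s *: g 1) = \pi_({ideal_quot I})%qT s.
  by rewrite linearZ_LR gK [LHS]mulr1.
exists (g 1) => [m|s sI].
  by exists (repr (f m)); apply: (can_inj fK); rewrite sE reprK.
apply: (can_inj fK); rewrite sE linear0 -[0](rmorph0 (\pi_({ideal_quot I}))%qT).
by apply/eqP; rewrite -Quotient.idealrBE subr0.
Qed.

Section TensorCyclic.
Variables (R : comNzRingType) (M N : lmodType R) (e : M) (e' : N).

Lemma tmul_generates : generates e -> generates e' -> generates (tmul e e').
Proof.
move=> ge ge'; apply: tensor_ind => [|_ _ [s ->] [s' ->]|m n].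
- by exists 0; rewrite scale0r.
- by exists (s + s'); rewrite scalerDl.
- have [s ->] := ge m; have [s' ->] := ge' n.
  by exists (s * s'); rewrite tmulZl tmulZr scalerA.
Qed.

Lemma tmul_killed (I : {pred R}) : killed_by I e -> killed_by I (tmul e e').
Proof. by move=> ke s sI; rewrite -tmulZl ke // -(scale0r e) tmulZl scale0r. Qed.

End TensorCyclic.

Section PointIdeal.
Variables (k : fieldType) (n d : nat).
Implicit Types (v w : {ffun 'I_n -> k}) (I : idealr {mpoly k[n]}).

Lemma separating_poly v w : w != v ->
  exists2 p : {mpoly k[n]}, p.@[v] = 1 & p.@[w] = 0.
Proof.
move=> wv; have /existsP[i vi] : [exists i, v i != w i].
  apply: contraR wv => /existsPn vw; apply/eqP/ffunP => i.
  by apply/esym/eqP; rewrite -[_ == _]negbK vw.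
exists ((v i - w i)^-1 *: ('X_i - (w i)%:MP)).
  by rewrite mevalZ mevalB mevalXU mevalC mulVf // subr_eq0.
by rewrite mevalZ mevalB mevalXU mevalC subrr mulr0.
Qed.

(** The product of the polynomials that separate [v] from the other points of [s]. *)
Lemma lagrange_poly v (s : seq {ffun 'I_n -> k}) :
  exists2 p : {mpoly k[n]}, p.@[v] = 1 & {in s, forall w, w != v -> p.@[w] = 0}.
Proof.
elim: s => [|w s [p pv ps]]; first by exists 1; rewrite ?meval1.
have [->|wv] := eqVneq w v.
  exists p => // x; rewrite inE => /orP[/eqP->|xs]; first by rewrite eqxx.
  exact: ps.
have [q qv qw] := separating_poly wv.
exists (p * q) => [|x]; first by rewrite mevalM pv qv mulr1.
rewrite inE mevalM => /orP[/eqP->|xs xv]; first by rewrite qw mulr0.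
by rewrite ps // mul0r.
Qed.

(** In coordinates the family is a square matrix whose rows span, hence invertible,
    so none of its rows is zero. *)
Lemma kdim_span_neq0 (N : lmodType {mpoly k[n]}) (b : 'I_d -> N) :
  has_kdim N d ->
  (forall m, exists c : 'I_d -> k, m = \sum_i (c i)%:MP *: b i) ->
  forall i, b i != 0.
Proof.
move=> [[r rlin rbij]] bspan i; have [r' rK r'K] := rbij.
pose rL := GRing.isLinear.Build k (kspace N) 'rV[k]_d _ r rlin.
pose ra : {linear kspace N -> 'rV[k]_d} := HB.pack r rL.
pose A := \matrix_j ra (b j).
have Afull : row_full A.
  apply/row_fullP; suff /choice[c cA] : forall j, exists c : 'rV_d, c *m A = delta_mx 0 j.
    exists (\matrix_j c j); apply/row_matrixP => j.
    by rewrite row_mul rowK cA row1.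
  move=> j; have [c cE] := bspan (r' (delta_mx 0 j)).
  exists (\row_i c i); rewrite mulmx_sum_row -[RHS]r'K cE -/(ra _).
  rewrite [RHS](linear_sum ra); apply: eq_bigr => l _.
  by rewrite rowK mxE -(linearZ_LR ra).
apply: contraTneq Afull => bi0; rewrite row_full_unit unitmxE unitfE negbK.
have Ai0 : row i A = 0 by rewrite rowK bi0 (linear0 ra).
rewrite (expand_det_row A i) big1 // => j _.
by have := congr1 (fun r : 'rV_d => r 0 j) Ai0; rewrite !mxE => ->; rewrite mul0r.
Qed.

(** The surjection from [S / I], of dimension [d], onto [N] is an isomorphism for
    dimension reasons. Concretely, the multiples of [u] by the [d] Lagrange
    polynomials span [N], and an annihilator of [u] outside [I] would kill one
    of them. *)
Lemma cyclic_ann_sub_ideal I (N : lmodType {mpoly k[n]}) (u : N) :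
  ideal_of_points d I -> has_kdim N d -> generates u -> killed_by I u ->
  forall s, s *: u = 0 -> s \in I.
Proof.
move=> [P Puniq IP] Ndim gu ku s su0; apply/IP => _ /tnthP[j ->].
have /choice[e eP] : forall i, exists p : {mpoly k[n]},
    forall l, p.@[tnth P l] = (l == i)%:R.
  move=> i; have [p pv ps] := lagrange_poly (tnth P i) P; exists p => l.
  have [->|li] := eqVneq l i; first exact: pv.
  by rewrite ps ?mem_tnth // (inj_eq (tuple_uniqP _ Puniq)).
(* Polynomials with the same values on the points differ by an element of [I]. *)
have congr_u f g : (forall l, f.@[tnth P l] = g.@[tnth P l]) -> f *: u = g *: u.
  move=> fg; apply/eqP; rewrite -subr_eq0 -scalerBl ku //.
  by apply/IP => _ /tnthP[l ->]; rewrite mevalB fg subrr.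
(* Lagrange interpolation: f is congruent to the sum of the f(P_i) e_i. *)
have /(_ j) : forall i, e i *: u != 0.
  apply: kdim_span_neq0 => // m; have [f ->] := gu m.
  exists (fun i => f.@[tnth P i]).
  under eq_bigr do rewrite scalerA.
  rewrite -scaler_suml; apply: congr_u => l.
  rewrite raddf_sum (bigD1 l) //= mevalM mevalC eP eqxx mulr1 big1 ?addr0 // => i il.
  by rewrite mevalM eP eq_sym (negPf il) mulr0.
(* If s(P_j) != 0, then e_j and s(P_j)^-1 e_j s agree on all points. *)
apply: contraNeq => sj; set a := s.@[_] in sj.
have -> : e j *: u = (a^-1%:MP * e j * s) *: u.
  apply: congr_u => l; rewrite !mevalM mevalC !eP.
  by have [->|] := eqVneq l j; rewrite ?mulr0 ?mul0r // mulr1 mulVf.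
by rewrite -scalerA su0 scaler0.
Qed.

Lemma tensor_surj_inj I (M1 M2 N : lmodType {mpoly k[n]})
    (q : {linear tensor M1 M2 -> N}) :
  ideal_of_points d I -> lmod_iso M1 {ideal_quot I} -> lmod_iso M2 {ideal_quot I} ->
  has_kdim N d -> surjective q -> injective q.
Proof.
move=> Ipts /ideal_quot_cyclic[e1 ge1 ke1] /ideal_quot_cyclic[e2 ge2 _] Ndim qs.
have gt := tmul_generates ge1 ge2; have kt := tmul_killed e2 ke1.
have gq : generates (q (tmul e1 e2)).
  by move=> m; have [y <-] := qs m; have [f ->] := gt y; exists f; rewrite linearZ.
have kq : killed_by I (q (tmul e1 e2)).
  by move=> f fI; rewrite -linearZ kt // linear0.
suff: forall x, q x = 0 -> x = 0 by exact: raddf_inj.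
move=> x; have [s ->] := gt x; rewrite linearZ_LR.
by move=> /(cyclic_ann_sub_ideal Ipts Ndim gq kq)/kt.
Qed.

End PointIdeal.

(** Both maps are injective by [tensor_surj_inj], so both kernels are zero. *)
Lemma inW_surj_same_ker (k : fieldType) (n d r1 r2 : nat) (x : bilin_pt k n d r1 r2)
    (N : lmodType {mpoly k[n]}) (q : {linear tensor (bmod1 x) (bmod2 x) -> N}) :
  inW x -> surjective q -> has_kdim N d -> same_ker (bpi x) q.
Proof.
move=> [I Ipts [iso1 iso2 _]] qs Ndim t.
have qi := tensor_surj_inj Ipts iso1 iso2 Ndim qs.
have pii := tensor_surj_inj Ipts iso1 iso2 (bdim3 x) (@bpi_surj _ _ _ _ _ x).
split=> t0; suff -> : t = 0 by rewrite linear0.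
  by apply: pii; rewrite linear0.
by apply: qi; rewrite linear0.
Qed.

Theorem proposition3p10 (k : closedFieldType) (n d r1 r2 : nat)
    (hn : (1 <= n)%N) (hd : (1 <= d)%N) (hr1 : (1 <= r1)%N) (hr2 : (1 <= r2)%N) :
  (forall x : bilin_pt k n d r1 r2, inW x ->
     forall (N : lmodType {mpoly k[n]})
            (q : {linear tensor (bmod1 x) (bmod2 x) -> N}),
       surjective q -> has_kdim N d ->
       same_ker (bpi x) q /\ quot_iso (bpi x) q) /\
  (forall x y : bilin_pt k n d r1 r2, inW x -> inW y ->
     same_ker (bp1 x) (bp1 y) -> same_ker (bp2 x) (bp2 y) ->
     same_pt x y).
Proof.
split=> [x Wx N q qs Ndim|x y Wx Wy k1 k2].
  have kq := inW_surj_same_ker Wx qs Ndim; split=> //.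
  exact: same_ker_quot_iso (@bpi_surj _ _ _ _ _ x) qs kq.
have [f1 [g1 _ f1K] f1E] :=
  same_ker_quot_iso (@bp1_surj _ _ _ _ _ x) (@bp1_surj _ _ _ _ _ y) k1.
have [f2 [g2 _ f2K] f2E] :=
  same_ker_quot_iso (@bp2_surj _ _ _ _ _ x) (@bp2_surj _ _ _ _ _ y) k2.
split=> //; exists f1, f2; split=> //.
(* The kernel comparison on the first tensor product is uniqueness of [pi] there,
   applied to the transported [pi] of the second point. *)
apply: inW_surj_same_ker => //; last exact: bdim3.
apply: surj_comp; first exact: bpi_surj.
by apply: tensor_map_surj => m; [exists (g1 m) | exists (g2 m)].
Qed.
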